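(* Let $Y=[y_L,y_U]$ be a random interval with $\mathbf E|y_L|+\mathbf E|y_U|<\infty$ and let $m\in\mathbb R$. Define $$A_-:=\{y_U<m\},\quad A_+:=\{y_L>m\},\quad M:=\{y_L\le m\le y_U\},$$ $p_-:=\mathbf P(A_-)$, $p_+:=\mathbf P(A_+)$, $p_0:=\mathbf P(M)=1-p_--p_+$, $\alpha_-(m):=(\tfrac12-p_-)_+$, $\alpha_+(m):=(\tfrac12-p_+)_+$, and on $M$ let $U_m:=y_U-m$ and $L_m:=m-y_L$. Let $F^{-1}_{U_m\mid M}$ and $F^{-1}_{L_m\mid M}$ be the left-continuous quantile functions of the conditional laws of $U_m$ and $L_m$ given $M$. Assume feasibility: $p_-\le\tfrac12$ and $p_+\le\tfrac12$. Then the attainable set of means under the median restriction is the closed interval $$\{\mathbf E[y]:y\in\mathbf{Sel}(Y\mid m)\}=\big[\mathbf E_{\min}(m),\ \mathbf E_{\max}(m)\big],$$ where $$\mathbf E_{\max}(m)=\mathbf E[y_U]-p_0\int_0^{\alpha_-(m)/p_0}F^{-1}_{U_m\mid M}(u)\,du,\qquad \mathbf E_{\min}(m)=\mathbf E[y_L]+p_0\int_0^{\alpha_+(m)/p_0}F^{-1}_{L_m\mid M}(u)\,du,$$ the integral terms being understood as $0$ when $p_0=0$. Both endpoints are attained by measurable selections in $\mathbf{Sel}(Y\mid m)$, and every value in $[\mathbf E_{\min}(m),\mathbf E_{\max}(m)]$ is attainable.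
   Context: $(\Omega,\mathcal A,\mathbf P)$ is a complete non-atomic probability space; $x_+=\max\{x,0\}$. A random interval is $Y(\omega)=[y_L(\omega),y_U(\omega)]\subset\mathbb R$ with $y_L,y_U$ measurable real-valued and $\mathbf P(y_L\le y_U)=1$. $\mathbf{Sel}(Y)$ is the set of measurable $y:\Omega\to\mathbb R$ with $y(\omega)\in Y(\omega)$ a.s. $\mathrm{Med}(z)$ is the set of all $m\in\mathbb R$ with $\mathbf P(z\le m)\ge\tfrac12$ and $\mathbf P(z\ge m)\ge\tfrac12$. The $m$-median restricted selection set is $\mathbf{Sel}(Y\mid m):=\{y\in\mathbf{Sel}(Y):m\in\mathrm{Med}(y)\}$. The left-continuous quantile function of a distribution function $F$ is $F^{-1}(u)=\inf\{t\in\mathbb R:F(t)\ge u\}$, $u\in(0,1)$. *)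

(* Defs.v *)
From HB Require Import structures.
From mathcomp Require Import all_boot all_order all_algebra.
From mathcomp Require Import all_classical all_reals all_analysis.

Set Implicit Arguments.
Unset Strict Implicit.
Unset Printing Implicit Defensive.

Import Order.TTheory GRing.Theory Num.Theory.
Import numFieldNormedType.Exports.

Local Open Scope classical_set_scope.
Local Open Scope ring_scope.

Definition nonatomic d (T : measurableType d) (R : realType)
    (P : probability T R) : Prop :=
  forall A : set T, measurable A -> (0 < P A)%E ->
    exists B : set T, [/\ measurable B, B `<=` A, (0 < P B)%E & (P B < P A)%E].

Section quantile.
Context d (T : measurableType d) (R : realType) (P : probability T R).

(* Meaningful when P M != 0. *)
Definition cond_law (M : set T) (X : T -> R) (B : set R) : R :=
  fine (P (M `&` X @^-1` B)) / fine (P M).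

Definition cond_cdf (M : set T) (X : T -> R) (t : R) : R :=
  cond_law M X `]-oo, t].

(* Left-continuous quantile function; meaningful for 0 < u < 1, where for a
   distribution function F the set is nonempty and bounded below. *)
Definition quantile (F : R -> R) (u : R) : R := inf [set t | u <= F t].

Definition median_set (z : T -> R) : set R :=
  [set m | ((2^-1)%:E <= P [set w | (z w <= m)%R])%E /\
           ((2^-1)%:E <= P [set w | (m <= z w)%R])%E].

End quantile.

Section random_intervals.
Context d (T : measurableType d) (R : realType) (P : probability T R).

Definition random_interval (yL yU : {RV P >-> R}) (w : T) : set R :=
  `[yL w, yU w].

Definition Sel (Y : T -> set R) : set {RV P >-> R} :=
  [set y : {RV P >-> R} | {ae P, forall w, Y w (y w)}].

Definition Sel_median (Y : T -> set R) (m : R) : set {RV P >-> R} :=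
  [set y : {RV P >-> R} | Sel Y y /\ median_set P y m].

Variables (yL yU : {RV P >-> R}) (m : R).

Definition A_minus : set T := [set w | yU w < m].
Definition A_plus : set T := [set w | m < yL w].
Definition A_mid : set T := [set w | yL w <= m <= yU w].

Definition p_minus : R := fine (P A_minus).
Definition p_plus : R := fine (P A_plus).
Definition p_mid : R := fine (P A_mid).

Definition alpha_minus : R := Num.max (2^-1 - p_minus) 0.
Definition alpha_plus : R := Num.max (2^-1 - p_plus) 0.

Definition upper_gap (w : T) : R := yU w - m.
Definition lower_gap (w : T) : R := m - yL w.

Local Open Scope ereal_scope.

Definition quantile_cost (X : T -> R) (a : R) : \bar R :=
  if p_mid == 0%R then 0
  else p_mid%:E * \int[lebesgue_measure]_(u in `]0%R, (a / p_mid)%R[)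
                    (quantile (cond_cdf P A_mid X) u)%:E.

Definition E_max : \bar R := 'E_P[yU] - quantile_cost upper_gap alpha_minus.
Definition E_min : \bar R := 'E_P[yL] + quantile_cost lower_gap alpha_plus.

End random_intervals.

Arguments random_interval {d T R} P yL yU w.
Arguments Sel {d T R} P Y.
Arguments Sel_median {d T R} P Y m.
Arguments A_minus {d T R} P yU m.
Arguments A_plus {d T R} P yL m.
Arguments A_mid {d T R} P yL yU m.
Arguments p_minus {d T R} P yU m.
Arguments p_plus {d T R} P yL m.
Arguments p_mid {d T R} P yL yU m.
Arguments alpha_minus {d T R} P yU m.
Arguments alpha_plus {d T R} P yL m.
Arguments upper_gap {d T R} P yU m w.
Arguments lower_gap {d T R} P yL m w.
Arguments quantile_cost {d T R} P yL yU m X a.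
Arguments E_max {d T R} P yL yU m.
Arguments E_min {d T R} P yL yU m.

(* Main.v *)
Require Import Defs.
From HB Require Import structures.
From mathcomp Require Import all_boot all_order all_algebra.
From mathcomp Require Import all_classical all_reals all_analysis.
From mathcomp Require Import measurable_realfun ring lra.

Import Order.TTheory GRing.Theory Num.Theory.
Import numFieldNormedType.Exports.

Set Implicit Arguments.
Unset Strict Implicit.
Unset Printing Implicit Defensive.

Local Open Scope classical_set_scope.
Local Open Scope ring_scope.
Local Open Scope ereal_scope.

(** The upper endpoint carries the whole argument; the lower one follows by
    applying it to [-yU, -yL] and [-m].

    A selection y has m as a median only if P (y <= m) >= 1/2.  Up to a null
    set, {y <= m} lies in A_- united with a part B of M, so B must have
    probability at least alpha_-, and pushing yU down to m on B costs at least
    the integral over B of the gap yU - m.  Hence the upper endpoint is a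
    bathtub problem: among the subsets of M of probability alpha, minimise the
    integral of the gap X >= 0.  By the layer-cake formula ([layer_cake]) the
    integral of X over B is the integral over t >= 0 of P (B and X > t), which
    is at least the positive part of alpha - P (M and X <= t), the
    [shortfall]; this is [bathtub_lower].  Equality holds when B is cut out of
    M along the level sets of X, ties at the critical level being broken by a
    set of prescribed probability.  Such a set exists because a nonatomic
    probability takes every intermediate value between nested sets
    ([nonatomic_between]); this is [bathtub_attained].  The layer-cake formula,
    now for Lebesgue measure on ]0, alpha / p0[ and the quantile function,
    turns the quantile integral into the same integral of the shortfall
    ([quantile_integral]), through the Galois connection between a
    distribution function and its quantile function.

    The selections with median m do not form a convex set, so intermediate
    values are not obtained by joining the two optimal selections directly.
    They are joined through a selection z that equals m on M, for instance m
    clamped to [yL, yU].  On the segment from the upper optimum to z nothing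
    above m crosses below it and the set B stays at m, so the median
    constraint holds throughout ([Sel_median_convex]) and the mean moves
    affinely from the upper endpoint to E[z].  Reflection covers the values
    between the lower endpoint and E[z]. *)

(** * Probabilities as real numbers *)

Section real_probability.
Context d (T : measurableType d) (R : realType) (P : probability T R).
Implicit Types A B C : set T.

Lemma fine_probK A : measurable A -> P A = (fine (P A))%:E.
Proof. by move=> mA; rewrite fineK// fin_num_measure. Qed.

Lemma fine_prob_le A B : measurable A -> measurable B -> A `<=` B ->
  (fine (P A) <= fine (P B))%R.
Proof.
by move=> mA mB AB; rewrite fine_le ?fin_num_measure// le_measure// inE.
Qed.

Lemma fine_probD A B : measurable A -> measurable B -> B `<=` A ->
  fine (P (A `\` B)) = (fine (P A) - fine (P B))%R.
Proof.
move=> mA mB BA; rewrite measureD//; last by rewrite -ge0_fin_numE ?fin_num_measure.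
by rewrite setIidr// fineB ?fin_num_measure.
Qed.

Lemma fine_probU A B : measurable A -> measurable B -> A `&` B = set0 ->
  fine (P (A `|` B)) = (fine (P A) + fine (P B))%R.
Proof. by move=> mA mB AB; rewrite measureU// fineD ?fin_num_measure. Qed.

Lemma fine_prob_bigcup_le (F : (set T)^nat) (a : R) :
  (forall n, measurable (F n)) -> nondecreasing_seq F ->
  (forall n, (fine (P (F n)) <= a)%R) -> (fine (P (\bigcup_n F n)) <= a)%R.
Proof.
move=> mF ndF Fa; have mU : measurable (\bigcup_n F n) by exact: bigcup_measurable.
rewrite -lee_fin -fine_probK//.
have cF := nondecreasing_cvg_mu (mu := P) mF mU ndF.
rewrite -(cvg_lim _ cF)//; apply: lime_le; first by apply/cvg_ex; eexists; exact: cF.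
by apply: nearW => n /=; rewrite fine_probK// lee_fin.
Qed.

End real_probability.

(** * Intermediate values of a nonatomic probability *)

Section nonatomic_values.
Context d (T : measurableType d) (R : realType) (P : probability T R).
Hypothesis Pna : nonatomic P.
Implicit Types A B C : set T.

(** Of the two pieces into which a set can be split, one has at most half of
    the probability; iterating gives arbitrarily small positive pieces. *)
Lemma nonatomic_small A (e : R) : measurable A -> (0 < P A) -> (0 < e)%R ->
  exists B, [/\ measurable B, B `<=` A, (0 < fine (P B))%R & (fine (P B) < e)%R].
Proof.
move=> mA A0 e0.
have halve n : exists B, [/\ measurable B, B `<=` A, (0 < fine (P B))%R &
    (fine (P B) <= 2^-1 ^+ n)%R].
  elim: n => [|n [B [mB BA B0 Bn]]].
    exists A; split => //; first by rewrite -lte_fin -fine_probK.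
    by rewrite expr0 -lee_fin -fine_probK// probability_le1.
  have [|C [mC CB C0 CltB]] := Pna mB; first by rewrite fine_probK// lte_fin.
  move: C0 CltB; rewrite (fine_probK P mB) (fine_probK P mC) !lte_fin => C0 CltB.
  have [CB2|CB2] := leP (fine (P C)) (fine (P B) / 2)%R.
    exists C; split=> //; first exact: subset_trans BA.
    by rewrite exprSr (le_trans CB2)// ler_wpM2r.
  exists (B `\` C); rewrite fine_probD//; split.
  - exact: measurableD.
  - by apply: subset_trans BA; exact: subDsetl.
  - by rewrite subr_gt0.
  - by rewrite exprSr; move: CB2 Bn; set x := (2^-1 ^+ n)%R; lra.
have /(_ e e0) : forall e : R, (0 < e)%R -> exists n, (2^-1 ^+ n < e :> R)%R.
  move=> {e0}e' e0; have := @cvg_geometric R 1%R (2^-1) _.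
  rewrite ger0_norm ?invr_ge0// => /(_ ltac:(lra)) /cvgr0Pnorm_lt /(_ _ e0).
  move=> [n _ /(_ n (leqnn n))] /=; rewrite mul1r => h; exists n.
  by apply: le_lt_trans h; exact: ler_norm.
case=> n ne; have [B [mB BA B0 Bn]] := halve n.
by exists B; split => //; exact: le_lt_trans ne.
Qed.

Let admissible A C (a : R) : set (set T) :=
  [set B | [/\ measurable B, A `<=` B, B `<=` C & (fine (P B) <= a)%R]].

(** Some admissible enlargement of [A] realises at least half of the largest
    possible gain in probability. *)
Lemma greedy_step A C (a : R) : admissible A C a A ->
  exists2 B, admissible A C a B &
    forall B', admissible A C a B' -> (fine (P B') + fine (P A) <= 2 * fine (P B))%R.
Proof.
move=> aA; pose E := [set fine (P B) | B in admissible A C a].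
have EA : E (fine (P A)) by exists A.
have hE : has_sup E.
  split; first by exists (fine (P A)).
  by exists a => _ [B [_ _ _ Ba]] <-.
have leE B : admissible A C a B -> (fine (P B) <= sup E)%R.
  by move=> aB; apply: (ub_le_sup hE.2); exists B.
have [lt|ge] := ltP (fine (P A)) (sup E); last first.
  exists A => // B /leE; lra.
have [|_ [B aB <-] supB] := @sup_adherent _ E ((sup E - fine (P A)) / 2) _ hE.
  by rewrite divr_gt0// subr_gt0.
exists B => // B' /leE; move: supB; lra.
Qed.

(** Sierpinski's theorem, by greedy exhaustion: iterate [greedy_step] from [A]
    and let [B] be the union of the resulting chain.  If [P B < a], a small
    piece [D] of [C `\` B] could be added at every stage, so every stage
    would gain at least half of [P D], which a probability cannot afford. *)
Lemma nonatomic_between A C (a : R) :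
  measurable A -> measurable C -> A `<=` C ->
  (fine (P A) <= a)%R -> (a <= fine (P C))%R ->
  exists B, [/\ measurable B, A `<=` B, B `<=` C & fine (P B) = a].
Proof.
move=> mA mC AC Aa aC.
have /choice[next nextP] : forall B, exists B', admissible B C a B ->
    admissible B C a B' /\
    (forall D, admissible B C a D -> (fine (P D) + fine (P B) <= 2 * fine (P B'))%R).
  move=> B; have [aB|naB] := pselect (admissible B C a B); last by exists B.
  by have [B' aB' B'P] := greedy_step aB; exists B'.
pose F n := iter n next A.
have FP n : admissible A C a (F n).
  elim: n => [|n [mF AF FC Fa]]; first by split.
  have [[mF' FF' F'C F'a] _] : _ := nextP (F n) (And4 mF (@subset_refl _ _) FC Fa).
  by split => //; exact: subset_trans FF'.
have FP' n : admissible (F n) C a (F n) by have [? ? ? ?] := FP n; split.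
have mF n : measurable (F n) by have [] := FP n.
have ndF : nondecreasing_seq F.
  apply/nondecreasing_seqP => n; apply/subsetPset.
  by have [[]] := nextP _ (FP' n).
pose B := \bigcup_n F n.
have mB : measurable B by exact: bigcup_measurable.
have BC : B `<=` C by apply: bigcup_sub => n _; have [] := FP n.
have FB n : F n `<=` B by exact: bigcup_sup.
have Ba : (fine (P B) <= a)%R.
  by apply: fine_prob_bigcup_le => // n; have [] := FP n.
exists B; split => //; first exact: (FB 0%N).
apply/eqP; rewrite eq_le Ba/= leNgt; apply/negP => Blt.
have [|||D [mD DCB D0 Dlt]] := @nonatomic_small (C `\` B) (a - fine (P B)).
- exact: measurableD.
- rewrite fine_probK ?lte_fin; last exact: measurableD.
  by rewrite fine_probD// subr_gt0 (lt_le_trans Blt).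
- by rewrite subr_gt0.
have step n : (fine (P (F n)) + fine (P D) / 2 <= fine (P (F n.+1)))%R.
  have [_ /(_ (F n `|` D))] := nextP _ (FP' n).
  have FD : F n `&` D = set0.
    by apply/seteqP; split=> // w [Fw /DCB[_]]; apply; exact: FB Fw.
  rewrite fine_probU//.
  have -> : next (F n) = F n.+1 by [].
  have FnB := fine_prob_le P (mF n) mB (FB n).
  suff aFD : admissible (F n) C a (F n `|` D) by move=> /(_ aFD); lra.
  split; [exact: measurableU|exact: subsetUl| |].
  - by move=> w [/FB/BC//|/DCB[]].
  - by rewrite fine_probU//; lra.
have lin n : (n%:R * (fine (P D) / 2) <= fine (P (F n)))%R.
  elim: n => [|n IH]; first by rewrite mul0r fine_ge0.
  by rewrite (le_trans _ (step n))// -natr1 mulrDl mul1r lerD2r.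
have D2 : (0 < fine (P D) / 2)%R by rewrite divr_gt0.
have := archi_boundP (x := (1 / (fine (P D) / 2))%R) _.
rewrite divr_ge0 ?ltW// => /(_ isT); set n := Num.bound _.
rewrite ltr_pdivrMr// ltNge => /negP; apply.
apply: le_trans (lin n) _.
by rewrite -lee_fin -fine_probK// probability_le1.
Qed.

End nonatomic_values.

(** * The layer-cake formula *)

Section layer_cake.
Context d (T : measurableType d) (R : realType).
Variable mu : {sigma_finite_measure set T -> \bar R}.

(** Both sides are the product measure of the region between 0 and the graph
    of [f] above [D], computed by vertical and by horizontal sections. *)
Lemma layer_cake (D : set T) (f : T -> R) : measurable D ->
  measurable_fun D f -> (forall x, D x -> (0 <= f x)%R) ->
  \int[mu]_(x in D) (f x)%:E =
  \int[lebesgue_measure]_(t in `[0%R, +oo[) mu (D `&` [set x | (t < f x)%R]).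
Proof.
move=> mD mf f0; pose g : T -> R := f \_ D.
have mg : measurable_fun setT g by apply/(measurable_restrictT _ mD).
have gD x : D x -> g x = f x by move=> Dx; rewrite /g patchE mem_set.
have gDC x : ~ D x -> g x = 0%R by move=> Dx; rewrite /g patchE memNset.
have g0 x : (0 <= g x)%R.
  by have [Dx|nDx] := pselect (D x); [rewrite gD// f0|rewrite gDC].
pose A := [set p : T * measurableTypeR R | (0 <= p.2)%R && (p.2 < g p.1)%R].
have mA : measurable A.
  pose h (p : T * measurableTypeR R) := (0 <= p.2)%R && (p.2 < g p.1)%R.
  have mh : measurable_fun setT h.
    apply: measurable_and; first exact: measurable_fun_ler.
    by apply: measurable_fun_ltr => //; exact: measurableT_comp mg _.
  by have := mh measurableT [set true] I; rewrite setTI.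
have := @indic_fubini_tonelli _ _ _ _ R mu (@lebesgue_measure R) A mA.
rewrite indic_fubini_tonelli_FE// indic_fubini_tonelli_GE// => H.
transitivity (\int[mu]_x (lebesgue_measure \o xsection A) x).
  rewrite integral_mkcond; apply: eq_integral => x _ /=.
  have -> : ((fun x => (f x)%:E) \_ D) x = (g x)%:E.
    by rewrite /g !patchE; case: ifP.
  have -> : xsection A x = `[0%R, g x[%classic.
    by apply/seteqP; split=> t; rewrite /xsection/= inE/= in_itv.
  rewrite lebesgue_measure_itv/= lte_fin; case: ltP => [gx|].
    by rewrite -EFinB subr0.
  by rewrite le_eqVlt ltNge g0 orbF => /eqP ->.
rewrite H [RHS]integral_mkcond; apply: eq_integral => t _ /=.
rewrite patchE; case: ifPn => [|].
  rewrite inE/= in_itv/= andbT => t0; congr (mu _).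
  apply/seteqP; split=> x; rewrite /ysection/= inE /A/= t0/=.
    have [Dx|nDx] := pselect (D x); first by rewrite gD.
    by rewrite gDC// ltNge t0.
  by move=> [Dx]; rewrite gD.
rewrite notin_setE/= in_itv/= andbT => /negP t0.
rewrite (_ : ysection _ _ = set0) ?measure0//.
by apply/seteqP; split=> x; rewrite /ysection/= inE /A/= (negbTE t0).
Qed.

End layer_cake.

(** * The bathtub problem and the quantile integral *)

Section bathtub.
Context d (T : measurableType d) (R : realType) (P : probability T R).
Variables (M : set T) (X : T -> R).
Hypothesis mM : measurable M.
Hypothesis mX : measurable_fun setT X.
Hypothesis X0 : forall w, M w -> (0 <= X w)%R.

Let below t := M `&` [set w | (X w <= t)%R].
Let G t : R := fine (P (below t)).
Let p : R := fine (P M).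

Let mXle t : measurable [set w | (X w <= t)%R].
Proof.
rewrite -[X in measurable X]setTI -preimage_itvNyc.
exact: mX.
Qed.

Let mXlt t : measurable [set w | (X w < t)%R].
Proof.
rewrite -[X in measurable X]setTI -preimage_itvNyo.
exact: mX.
Qed.

Let mbelow t : measurable (below t).
Proof. exact: measurableI. Qed.

Lemma subcdf_homo t s : (t <= s)%R -> (G t <= G s)%R.
Proof.
move=> ts; apply: fine_prob_le => // w [Mw /= Xt]; split=> //=.
exact: le_trans ts.
Qed.

Lemma subcdf_neg t : (t < 0)%R -> G t = 0%R.
Proof.
move=> t0; rewrite /G (_ : below t = set0) ?measure0//.
apply/seteqP; split=> // w [/X0 Xw /= Xt].
by have := lt_le_trans t0 (le_trans Xw Xt); rewrite ltxx.
Qed.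

Lemma subcdf_right_cont a t :
  (forall s, (t < s)%R -> (a <= G s)%R) -> (a <= G t)%R.
Proof.
move=> aG; pose F n := M `\` below (t + n.+1%:R^-1)%R.
have mF n : measurable (F n) by exact: measurableD.
have UF : \bigcup_n F n = M `\` below t.
  apply/seteqP; split=> w /=.
    move=> [n _ [Mw nb]]; split=> //; apply: contra_not nb => -[_ /= Xt].
    by split=> //=; rewrite (le_trans Xt)// lerDl.
  move=> [Mw nb]; have tX : (t < X w)%R.
    by rewrite ltNge; apply/negP => Xt; apply: nb.
  have [n tn] := ltr_add_invr tX.
  by exists n => //; split=> // -[_ /=]; rewrite leNgt tn.
have : (fine (P (\bigcup_n F n)) <= p - a)%R.
  apply: fine_prob_bigcup_le => //.
    move=> n k nk; apply/subsetPset => w [Mw nb]; split=> //.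
    apply: contra_not nb => -[_ /= Xt]; split=> //=; rewrite (le_trans Xt)//.
    by rewrite lerD2l lef_pV2 ?posrE// ler_nat.
  move=> n; rewrite fine_probD//; last by move=> w [].
  by rewrite lerD2l lerN2 aG// ltrDl.
by rewrite UF fine_probD ?lerD2l ?lerN2//; move=> w [].
Qed.

Lemma subcdf_left a t : (forall s, (s < t)%R -> (G s <= a)%R) ->
  (fine (P (M `&` [set w | (X w < t)%R])) <= a)%R.
Proof.
move=> Ga; pose F n := below (t - n.+1%:R^-1)%R.
have -> : M `&` [set w | (X w < t)%R] = \bigcup_n F n.
  apply/seteqP; split=> w /=.
    move=> [Mw Xt]; have [n nt] := ltr_add_invr Xt.
    by exists n => //; split => //=; rewrite lerBrDr ltW.
  move=> [n _ [Mw /= Xt]]; split=> //; rewrite (le_lt_trans Xt)//.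
  by rewrite ltrBlDr ltrDl.
apply: fine_prob_bigcup_le => [n|n k nk|n].
- exact: mbelow.
- apply/subsetPset => w [Mw /= Xt]; split=> //=; rewrite (le_trans Xt)//.
  by rewrite lerD2l lerN2 lef_pV2 ?posrE// ler_nat.
- by rewrite Ga// ltrBlDr ltrDl.
Qed.

Lemma subcdf_sup a : (forall t, (G t <= a)%R) -> (p <= a)%R.
Proof.
move=> Ga; rewrite /p (_ : M = \bigcup_n below n%:R%R).
  apply: fine_prob_bigcup_le => [n|n k nk|n]; [exact: mbelow| |exact: Ga].
  apply/subsetPset => w [Mw /= Xt]; split=> //=; rewrite (le_trans Xt)//.
  by rewrite ler_nat.
apply/seteqP; split=> [w Mw|w [n _ []]//].
exists (Num.bound (X w)) => //; split=> //=; apply/ltW/archi_boundP; exact: X0.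
Qed.

(** The least probability that a subset of [M] of probability [a] must put
    above level [t]. *)
Definition shortfall (a t : R) : R := Num.max (a - G t)%R 0%R.

Lemma shortfall_measurable a D : measurable D ->
  measurable_fun D (fun t => (shortfall a t)%:E).
Proof.
move=> mD; apply/measurable_EFinP; apply: nonincreasing_measurable => // s t st.
rewrite /shortfall ge_max !le_max lexx orbT andbT lerD2l lerN2.
by rewrite subcdf_homo.
Qed.

Lemma shortfall_ge0 a t : (0 <= shortfall a t)%R.
Proof. by rewrite le_max lexx orbT. Qed.

Lemma tail_prob B t : measurable B ->
  P (B `&` [set w | (t < X w)%R]) =
  (fine (P B) - fine (P (B `&` [set w | (X w <= t)%R])))%:E.
Proof.
move=> mB; rewrite -fine_probD//; last exact: measurableI.
have -> : B `\` (B `&` [set w | (X w <= t)%R]) = B `&` [set w | (t < X w)%R].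
  apply/seteqP; split=> w /= [Bw].
    by move=> h; split=> //; rewrite ltNge; apply/negP => Xt; apply: h.
  by move=> tX; split=> // -[_]; rewrite leNgt tX.
rewrite -fine_probK//; apply: measurableI => //.
rewrite -[X in measurable X]setTI -preimage_itvoy.
exact: mX.
Qed.

Lemma bathtub_layer B : measurable B -> B `<=` M ->
  \int[P]_(w in B) (X w)%:E = \int[lebesgue_measure]_(t in `[0%R, +oo[)
    (fine (P B) - fine (P (B `&` [set w | (X w <= t)%R])))%:E.
Proof.
move=> mB BM; rewrite layer_cake//.
- by apply: eq_integral => t _; exact: tail_prob.
- exact: measurable_funTS.
- by move=> w /BM; exact: X0.
Qed.

(** Any [B] within [M] of probability at least [a] leaves at least the
    shortfall above each level. *)
Lemma bathtub_lower B a : measurable B -> B `<=` M -> (a <= fine (P B))%R ->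
  \int[lebesgue_measure]_(t in `[0%R, +oo[) (shortfall a t)%:E
    <= \int[P]_(w in B) (X w)%:E.
Proof.
move=> mB BM aB; rewrite bathtub_layer//; apply: ge0_le_integral => //.
- by move=> t _; rewrite lee_fin shortfall_ge0.
- exact: shortfall_measurable.
- apply/measurable_EFinP; apply: nonincreasing_measurable => // s t st.
  rewrite lerD2l lerN2; apply: fine_prob_le; [exact: measurableI..|].
  by move=> w [Bw /= Xt]; split=> //=; exact: le_trans st.
- move=> t _; rewrite lee_fin ge_max subr_ge0; apply/andP; split.
    apply: lerB => //; apply: fine_prob_le => //; first exact: measurableI.
    by move=> w [/BM].
  by apply: fine_prob_le => //; exact: measurableI.
Qed.

(** The optimal [B] fills [M] from the lowest values of [X] upwards: it
    contains {X < q} and is contained in {X <= q} for a critical level [q].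
    Each level [t] then either bounds [X] on all of [B] or has everything
    below it inside [B], and both cases give equality in [bathtub_lower]. *)
Lemma bathtub_attained (Pna : nonatomic P) a : (0 <= a <= p)%R ->
  exists B, [/\ measurable B, B `<=` M, fine (P B) = a &
    \int[P]_(w in B) (X w)%:E =
    \int[lebesgue_measure]_(t in `[0%R, +oo[) (shortfall a t)%:E].
Proof.
move=> /andP[a0 ap].
suff [B [mB BM Ba cut]] : exists B, [/\ measurable B, B `<=` M, fine (P B) = a &
    forall t, (0 <= t)%R ->
      B `<=` [set w | (X w <= t)%R] \/ below t `<=` B].
  exists B; split=> //; rewrite bathtub_layer//.
  apply: eq_integral => t; rewrite inE/= in_itv/= andbT => t0; congr EFin.
  have mBt : measurable (B `&` [set w | (X w <= t)%R]) by exact: measurableI.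
  have le1 : (fine (P (B `&` [set w | (X w <= t)%R])) <= G t)%R.
    by apply: fine_prob_le => // w [/BM].
  have [BX|XB] := cut t t0.
    have -> : B `&` [set w | (X w <= t)%R] = B by exact/setIidPl.
    have : (fine (P B) <= G t)%R by apply: fine_prob_le => // w Bw; split; auto.
    by rewrite /shortfall Ba subrr -subr_le0 => ?; rewrite max_r.
  have -> : B `&` [set w | (X w <= t)%R] = below t.
    apply/seteqP; split=> w; first by move=> [/BM].
    by move=> h; split; [exact: XB|case: h].
  rewrite Ba /shortfall max_l// subr_ge0 -Ba; exact: fine_prob_le.
(* The critical level is finite and nonnegative only when 0 < a < p. *)
move: a0; rewrite le_eqVlt => /predU1P[<-|a0].
  by exists set0; split=> //; [rewrite measure0|move=> t _; left].
move: ap; rewrite le_eqVlt => /predU1P[->|ap].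
  by exists M; split=> // t _; right=> w [].
pose E := [set t | (a <= G t)%R].
have E0 : E !=set0.
  apply/not_existsP => nE.
  have : (p <= a)%R.
    by apply: subcdf_sup => t; rewrite leNgt; apply/negP => /ltW; exact: nE.
  by rewrite leNgt ap.
have lbE : lbound E 0%R.
  move=> t; rewrite /E/= => aG; rewrite leNgt; apply/negP => t0.
  by move: aG; rewrite subcdf_neg// leNgt a0.
have hE : has_inf E by split=> //; exists 0%R.
pose q := inf E.
have qG : (a <= G q)%R.
  apply: subcdf_right_cont => s qs.
  have [||e Ee] := @inf_adherent _ E (s - q)%R; [by rewrite subr_gt0|by []|].
  rewrite addrC subrK => es.
  by apply: le_trans (subcdf_homo (ltW es)).
have Gq : (fine (P (M `&` [set w | (X w < q)%R])) <= a)%R.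
  apply: subcdf_left => s sq; rewrite leNgt; apply/negP => /ltW Es.
  by have := ge_inf hE.2 Es; rewrite leNgt sq.
have [||B [mB AB BC Ba]] := nonatomic_between Pna _ (mbelow q) _ Gq qG.
- exact: measurableI.
- by move=> w [Mw /= /ltW].
exists B; split=> //; first by move=> w /BC[].
move=> t _; have [tq|qt] := ltP t q.
  by right=> w [Mw /= Xt]; apply: AB; split=> //=; exact: le_lt_trans tq.
by left=> w /BC[_ /= Xq]; exact: le_trans qt.
Qed.

Lemma cond_cdfE t : cond_cdf P M X t = (G t / p)%R.
Proof.
by rewrite /cond_cdf /cond_law (_ : X @^-1` _ = [set w | (X w <= t)%R]).
Qed.

(** The defining infimum is attained, by right continuity of the conditional
    distribution function. *)
Lemma quantile_galois u t : (0 < p)%R -> (0 < u < 1)%R ->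
  (quantile (cond_cdf P M X) u <= t)%R = (u <= cond_cdf P M X t)%R.
Proof.
move=> p0 /andP[u0 u1]; pose E := [set t | (u <= cond_cdf P M X t)%R].
have EE s : E s <-> (u * p <= G s)%R by rewrite /E/= cond_cdfE ler_pdivlMr.
have E0 : E !=set0.
  apply/not_existsP => nE.
  have : (p <= u * p)%R.
    by apply: subcdf_sup => s; rewrite leNgt; apply/negP => /ltW/EE; exact: nE.
  by rewrite leNgt gtr_pMl// u1.
have hE : has_inf E.
  split=> //; exists 0%R => s /EE uG; rewrite leNgt; apply/negP => s0.
  by move: uG; rewrite subcdf_neg// leNgt mulr_gt0.
apply/idP/idP => [Qt|Et]; last exact: (ge_inf hE.2 (Et : E t)).
apply/EE; apply: subcdf_right_cont => s ts.
have [||e /EE Ge es] := @inf_adherent _ E (s - t)%R; [by rewrite subr_gt0|by []|].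
apply: le_trans Ge (subcdf_homo _); move: es Qt.
by rewrite (_ : inf E = quantile (cond_cdf P M X) u)//; lra.
Qed.

(** By the Galois connection the part of ]0, a / p[ where the quantile
    function exceeds [t] is the interval from F(t) to a / p; its length times
    [p] is the shortfall at [t]. *)
Lemma quantile_integral a : (0 < p)%R -> (0 <= a <= p)%R ->
  p%:E * \int[lebesgue_measure]_(u in `]0%R, (a / p)%R[)
           (quantile (cond_cdf P M X) u)%:E =
  \int[lebesgue_measure]_(t in `[0%R, +oo[) (shortfall a t)%:E.
Proof.
move=> p0 /andP[a0 ap]; set Q := quantile _.
have ap1 : (a / p <= 1)%R by rewrite ler_pdivrMr ?mul1r.
have u01 u : `]0%R, (a / p)%R[%classic u -> (0 < u < 1)%R.
  by rewrite /= in_itv/= => /andP[-> ua]; rewrite (lt_le_trans ua).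
have gal u t : `]0%R, (a / p)%R[%classic u -> (t < Q u)%R = (cond_cdf P M X t < u)%R.
  by move=> /u01 uu; rewrite !ltNge quantile_galois.
have tail t : `]0%R, (a / p)%R[ `&` [set u | (t < Q u)%R] =
    `]0%R, (a / p)%R[ `&` `](cond_cdf P M X t), +oo[.
  apply/seteqP; split=> u [Du] /=; rewrite ?in_itv/= ?andbT => tu; split=> //=.
    by rewrite -gal.
  by rewrite gal.
have F0 t : (0 <= cond_cdf P M X t)%R by rewrite cond_cdfE divr_ge0// fine_ge0.
rewrite layer_cake//; last 2 first.
- apply: (measurability _ (RGenOInfty.measurableE R)).
  move=> _ [_ [t ->] <-]; rewrite preimage_itvoy tail.
  exact: measurableI.
- move=> u Du; rewrite leNgt; apply/negP => Q0.
  have := quantile_galois (Q u) p0 (u01 _ Du); rewrite lexx cond_cdfE subcdf_neg//.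
  by rewrite mul0r; have /andP[u0 _] := u01 _ Du; rewrite leNgt u0.
have lev t : lebesgue_measure (`]0%R, (a / p)%R[ `&` [set u | (t < Q u)%R]) =
    (Num.max (a / p - cond_cdf P M X t)%R 0%R)%:E.
  rewrite tail (_ : _ `&` _ = `](cond_cdf P M X t), (a / p)%R[%classic); last first.
    apply/seteqP; split=> u; rewrite /= !in_itv/= ?andbT.
      by move=> [/andP[_ ->] ->].
    by move=> /andP[Fu ->]; rewrite Fu (le_lt_trans (F0 t) Fu).
  rewrite lebesgue_measure_itv/= lte_fin; case: ltP => h.
    by rewrite -EFinB max_l// subr_ge0 ltW.
  by rewrite max_r// subr_le0.
transitivity (p%:E * \int[lebesgue_measure]_(t in `[0%R, +oo[)
    (Num.max (a / p - cond_cdf P M X t)%R 0%R)%:E).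
  by congr (_ * _); apply: eq_integral => t _; exact: lev.
rewrite -ge0_integralZl//; last 3 first.
- apply/measurable_EFinP; apply: nonincreasing_measurable => // s t st.
  rewrite ge_max !le_max lexx orbT andbT lerD2l lerN2 !cond_cdfE.
  by rewrite ler_pM2r ?invr_gt0// subcdf_homo.
- by move=> t _; rewrite lee_fin le_max lexx orbT.
- by rewrite lee_fin ltW.
apply: eq_integral => t _; rewrite -EFinM; congr EFin.
rewrite maxr_pMr ?ltW// mulr0 mulrBr cond_cdfE.
by rewrite mulrC divfK ?gt_eqF// mulrC divfK ?gt_eqF.
Qed.

End bathtub.

(** * Almost sure comparisons *)

Section integrable_ae.
Context d (T : measurableType d) (R : realType) (P : probability T R).

Lemma ae_prob_le (A B : set T) : measurable A -> measurable B ->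
  {ae P, forall w, A w -> B w} -> (fine (P A) <= fine (P B))%R.
Proof.
move=> mA mB AB; have mAB : measurable (A `\` B) by exact: measurableD.
have AB0 : P (A `\` B) = 0.
  apply: measure_negligible => //; apply: negligibleS AB => w [Aw nBw] /=.
  by move=> /(_ Aw).
rewrite fine_le ?fin_num_measure//.
rewrite -[leRHS]adde0 -AB0; apply: (@le_trans _ _ (P (B `|` A `\` B))); last exact: measureU2.
rewrite le_measure ?inE//; first exact: measurableU.
by move=> w Aw; have [Bw|nBw] := pselect (B w); [left|right].
Qed.

Lemma ae_integral_le (f g : T -> R) : P.-integrable setT (EFin \o f) ->
  P.-integrable setT (EFin \o g) -> {ae P, forall w, (f w <= g w)%R} ->
  \int[P]_w (f w)%:E <= \int[P]_w (g w)%:E.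
Proof.
move=> fi gi fg.
have mf : measurable_fun setT f by apply/measurable_EFinP/(measurable_int P).
have mg : measurable_fun setT g by apply/measurable_EFinP/(measurable_int P).
rewrite -sube_ge0; last by rewrite integrable_fin_num.
rewrite -integralB_EFin//.
rewrite (@ae_eq_integral _ _ _ _ _ (fun w => (Num.max (g w - f w) 0)%R%:E))//.
- by apply: integral_ge0 => w _; rewrite lee_fin le_max lexx orbT.
- by apply/measurable_EFinP; exact: measurable_funB.
- by apply/measurable_EFinP; apply: measurable_maxr => //; exact: measurable_funB.
- by apply: filterS fg => w fg _ /=; rewrite max_l// subr_ge0.
Qed.

Lemma random_variable_of (f : T -> R) : measurable_fun setT f ->
  exists y : {RV P >-> R}, (y : T -> R) = f.
Proof. by move=> mf; exists (mfun_Sub (mem_set mf)). Qed.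

End integrable_ae.

(** * The upper endpoint *)

Section upper_end.
Context d (T : measurableType d) (R : realType) (P : probability T R).
Variables (yL yU : {RV P >-> R}) (m : R).
Hypothesis LU : {ae P, forall w, (yL w <= yU w)%R}.
Hypothesis iL : P.-integrable setT (EFin \o yL).
Hypothesis iU : P.-integrable setT (EFin \o yU).
Hypothesis feas_minus : (p_minus P yU m <= 2^-1)%R.
Hypothesis feas_plus : (p_plus P yL m <= 2^-1)%R.

Let Y := random_interval P yL yU.
Let M := A_mid P yL yU m.
Let gap := upper_gap P yU m.

Let mle (f g : T -> R) : measurable_fun setT f -> measurable_fun setT g ->
  measurable [set w | (f w <= g w)%R].
Proof.
move=> mf mg; have := measurable_fun_ler mf mg measurableT (Y := [set true]) I.
by rewrite setTI.
Qed.

Let mlt (f g : T -> R) : measurable_fun setT f -> measurable_fun setT g ->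
  measurable [set w | (f w < g w)%R].
Proof.
move=> mf mg; have := measurable_fun_ltr mf mg measurableT (Y := [set true]) I.
by rewrite setTI.
Qed.

Let mAm : measurable (A_minus P yU m). Proof. exact: mlt. Qed.
Let mAp : measurable (A_plus P yL m). Proof. exact: mlt. Qed.

Let mM : measurable M.
Proof.
have -> : M = [set w | (yL w <= m)%R] `&` [set w | (m <= yU w)%R].
  by apply/seteqP; split=> w /andP.
by apply: measurableI; exact: mle.
Qed.

Let mgap : measurable_fun setT gap.
Proof. exact: measurable_funB. Qed.

Let gap0 w : M w -> (0 <= gap w)%R.
Proof. by move=> /andP[_]; rewrite subr_ge0. Qed.

Let igap : P.-integrable setT (EFin \o gap).
Proof.
by have := integrableB measurableT iU (finite_measure_integrable_cst P m measurableT).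
Qed.

(** The three events A_-, A_+ and M cover the whole space, so feasibility on
    the right, [p_plus <= 1/2], leaves enough room in [M]. *)
Lemma alpha_minus_itv : (0 <= alpha_minus P yU m <= p_mid P yL yU m)%R.
Proof.
rewrite /alpha_minus le_max lexx orbT/= ge_max fine_ge0 ?andbT//.
have : (fine (P setT) <= p_minus P yU m + (p_plus P yL m + p_mid P yL yU m))%R.
  have mU : measurable (A_plus P yL m `|` M) by exact: measurableU.
  have Ule A B : measurable A -> measurable B ->
      (fine (P (A `|` B)) <= fine (P A) + fine (P B))%R.
    move=> mA mB; rewrite -fineD ?fin_num_measure// fine_le ?fin_num_measure//.
    - exact: measurableU.
    - by rewrite fin_numD !fin_num_measure.
    - exact: measureU2.
  apply: le_trans (le_trans (Ule _ _ mAm mU) _); last by rewrite lerD2l Ule.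
  apply: fine_prob_le => //; first exact: measurableU.
  move=> w _; have [h|h] := ltP (yU w) m; [by left|right].
  have [h'|h'] := ltP m (yL w); [by left|right].
  by rewrite /M /A_mid/= h' h.
rewrite probability_setT/=; move: feas_plus; lra.
Qed.

Lemma quantile_cost_shortfall : quantile_cost P yL yU m gap (alpha_minus P yU m) =
  \int[lebesgue_measure]_(t in `[0%R, +oo[) (shortfall P M gap (alpha_minus P yU m) t)%:E.
Proof.
have /andP[a0 ap] := alpha_minus_itv.
rewrite /quantile_cost; case: eqP => [p0|/eqP p0]; last first.
  by apply: quantile_integral => //; rewrite ?a0// lt_neqAle eq_sym p0 fine_ge0.
rewrite integral0_eq// => t _; congr EFin; apply: max_r.
by rewrite subr_le0 (le_trans ap)// p0 fine_ge0.
Qed.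

(** The upper selection lowered to [m] on [B]: the gap is exactly what has to
    be removed there. *)
Let push B (w : T) : R := (yU w - (gap \_ B) w)%R.

Lemma push_in B w : B w -> push B w = m.
Proof. by move=> Bw; rewrite /push patchE mem_set// /gap /upper_gap subKr. Qed.

Lemma push_out B w : ~ B w -> push B w = yU w.
Proof. by move=> Bw; rewrite /push patchE memNset// subr0. Qed.

Let igapB B : measurable B -> P.-integrable setT (EFin \o gap \_ B).
Proof.
move=> mB; rewrite -restrict_EFin; apply/(integrable_mkcond (EFin \o gap) mB).
exact: (integrableS measurableT mB (@subsetT _ _) igap).
Qed.

Let ipush B : measurable B -> P.-integrable setT (EFin \o push B).
Proof. by move=> mB; have := integrableB measurableT iU (igapB mB). Qed.

Lemma integral_push B : measurable B ->
  \int[P]_w (push B w)%:E = 'E_P[yU] - \int[P]_(w in B) (gap w)%:E.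
Proof.
move=> mB; rewrite /push integralB_EFin//; last exact: igapB.
rewrite unlock; congr (_ - _).
by rewrite [RHS]integral_mkcond; apply: eq_integral => w _; rewrite restrict_EFin.
Qed.

Lemma Sel_integrable (y : {RV P >-> R}) : Sel P Y y ->
  P.-integrable setT (EFin \o y).
Proof.
move=> Yy; apply/integrableP; split; first exact/measurable_EFinP.
have iLU := integrableD measurableT (integrable_abse iL) (integrable_abse iU).
apply: le_lt_trans (integrable_lty _ iLU) => //.
apply: ae_ge0_le_integral => //=.
- by apply/measurable_EFinP; exact: measurableT_comp.
- by move=> w _; rewrite adde_ge0.

- exact: (measurable_int P iLU).
- apply: filterS Yy => w; rewrite /Y /random_interval/= in_itv/= => /andP[Ly yU'] _.
  rewrite -EFinD lee_fin; have [y0|y0] := ger0P (y w).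
    by rewrite (le_trans yU')// (le_trans (ler_norm _))// lerDr.
  by rewrite (@le_trans _ _ (- yL w)%R) ?lerN2// (le_trans (ler_norm _))// normrN lerDl.
Qed.

(** Where [y <= m] within [M], the selection is at most [m]; elsewhere it is
    at most [yU].  So [y] is dominated by [push B] for this [B], whose cost is
    bounded by the bathtub inequality. *)
Lemma Sel_median_le_E_max (y : {RV P >-> R}) : Sel_median P Y m y ->
  'E_P[y] <= E_max P yL yU m.
Proof.
move=> [Yy [med _]]; pose B := M `&` [set w | (y w <= m)%R].
have mB : measurable B by apply: measurableI => //; exact: mle.
have aB : (alpha_minus P yU m <= fine (P B))%R.
  rewrite ge_max fine_ge0// andbT lerBlDl.
  move: med; rewrite fine_probK; last exact: mle.
  rewrite lee_fin => /le_trans; apply.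
  rewrite -fine_probU//; last first.
    apply/seteqP; split=> // w [/= yUm [/andP[_ h] _]].
    by move: yUm; rewrite /A_minus/= ltNge h.
  apply: ae_prob_le; [exact: mle|exact: measurableU|].
  apply: filterS Yy => w; rewrite /Y /random_interval/= in_itv/= => /andP[Ly yU'] ym.
  have [h|h] := ltP (yU w) m; [by left|right; split=> //].
  by rewrite /M /A_mid/= h (le_trans Ly ym).
apply: (@le_trans _ _ (\int[P]_w (push B w)%:E)).
  rewrite unlock; apply: ae_integral_le; [exact: Sel_integrable|exact: ipush|].
  apply: filterS Yy => w; rewrite /Y /random_interval/= in_itv/= => /andP[_ yU'].
  have [Bw|Bw] := pselect (B w); last by rewrite push_out.
  by rewrite push_in//; case: Bw.
rewrite integral_push// leeB// -/gap quantile_cost_shortfall.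
by apply: bathtub_lower => // w [].
Qed.

Lemma E_max_push (Pna : nonatomic P) : exists B, [/\ measurable B, B `<=` M,
  fine (P B) = alpha_minus P yU m & \int[P]_w (push B w)%:E = E_max P yL yU m].
Proof.
have [B [mB BM Ba Bint]] := bathtub_attained mM mgap gap0 Pna alpha_minus_itv.
exists B; split=> //.
by rewrite integral_push// /E_max -/gap quantile_cost_shortfall Bint.
Qed.

(** Almost surely both [push B] and [z] are below [m] on A_-, equal to [m] on
    [B], and at least [m] off A_-; these properties survive convex
    combinations, and they give the two halves of the median condition. *)
Lemma Sel_median_convex (B : set T) (z y : {RV P >-> R}) (s : R) :
  measurable B -> B `<=` M -> (alpha_minus P yU m <= fine (P B))%R ->
  Sel P Y z -> (forall w, M w -> z w = m) -> (0 <= s <= 1)%R ->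
  (forall w, y w = (1 - s) * push B w + s * z w)%R -> Sel_median P Y m y.
Proof.
move=> mB BM aB Yz zM /andP[s0 s1] yE.
have conv (a b : R) (w : T) : (a <= push B w <= b)%R -> (a <= z w <= b)%R ->
    (a <= y w <= b)%R.
  rewrite yE => /andP[? ?] /andP[? ?]; apply/andP; split; nra.
split; [|split].
- apply: filterS2 LU Yz => w yLU; rewrite /Y /random_interval/= !in_itv/=.
  apply: conv; have [Bw|Bw] := pselect (B w); last by rewrite push_out// yLU lexx.
  by rewrite push_in//; exact: BM.
- rewrite fine_probK; last exact: mle.
  rewrite lee_fin; apply: (@le_trans _ _ (fine (P (A_minus P yU m `|` B)))).
    rewrite fine_probU//.
      by move: aB; rewrite /alpha_minus ge_max => /andP[]; rewrite lerBlDl.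
    apply/seteqP; split=> // w [/= yUm /BM/andP[_ h]].
    by move: yUm; rewrite /A_minus/= ltNge h.
  apply: ae_prob_le; [exact: measurableU|exact: mle|].
  apply: filterS Yz => w; rewrite /Y /random_interval/= in_itv/= => /andP[Lz zU] [|Bw].
    rewrite /A_minus/= => yUm.
    have nB : ~ B w by move=> /BM/andP[_]; rewrite leNgt yUm.
    rewrite yE push_out//; nra.
  by rewrite yE push_in// zM; [nra|exact: BM].
- rewrite fine_probK; last exact: mle.
  rewrite lee_fin; apply: (@le_trans _ _ (fine (P (~` A_minus P yU m)))).
    rewrite probability_setC// fine_probK// -EFinB/=.
    move: feas_minus; rewrite /p_minus; lra.
  apply: ae_prob_le; [exact: measurableC|exact: mle|].
  apply: filterS Yz => w; rewrite /Y /random_interval/= in_itv/= => /andP[Lz zU].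
  rewrite /A_minus/= => /negP; rewrite -leNgt => myU.
  have mp : (m <= push B w)%R.
    by have [Bw|Bw] := pselect (B w); [rewrite push_in|rewrite push_out].
  have mz : (m <= z w)%R.
    have [Lm|mL] := leP (yL w) m; last by rewrite (le_trans (ltW mL)).
    by rewrite zM// /M /A_mid/= Lm.
  rewrite yE; nra.
Qed.

(** All means between that of [z] and the upper endpoint are reached along the
    segment from the optimal pushed-down selection to [z]. *)
Lemma upper_half (Pna : nonatomic P) (z : {RV P >-> R}) :
  Sel P Y z -> (forall w, M w -> z w = m) ->
  [/\ E_max P yL yU m \is a fin_num,
      'E_P[z] <= E_max P yL yU m &
      forall v : R, 'E_P[z] <= v%:E <= E_max P yL yU m ->
        exists2 y : {RV P >-> R}, Sel_median P Y m y & 'E_P[y] = v%:E].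
Proof.
move=> Yz zM; have [B [mB BM Ba pushE]] := E_max_push Pna.
have iz := Sel_integrable Yz; have ip := ipush mB.
have fM : E_max P yL yU m \is a fin_num by rewrite -pushE integrable_fin_num.
have fz : 'E_P[z] \is a fin_num by rewrite unlock integrable_fin_num.
have convex s : (0 <= s <= 1)%R -> exists2 y : {RV P >-> R}, Sel_median P Y m y &
    'E_P[y] = (1 - s)%:E * E_max P yL yU m + s%:E * 'E_P[z].
  move=> s01; have mpush : measurable_fun setT (push B).
    by apply/measurable_EFinP/(measurable_int P).
  have [|y yE] := @random_variable_of _ _ _ P (fun w => (1 - s) * push B w + s * z w)%R.
    by apply: measurable_funD; exact: measurable_funM.
  exists y; first by apply: (Sel_median_convex mB BM _ Yz zM s01) => [|w];
    rewrite ?Ba ?yE.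
  rewrite -pushE unlock yE integralD_EFin//; last 2 first.
  - by have := integrableZl measurableT (1 - s)%R ip.
  - by have := integrableZl measurableT s iz.
  by rewrite -!integralZl.
split=> //.
  have [|y Yy] := convex 1%R; first by rewrite ler01 lexx.
  by rewrite subrr mul0e add0e mul1e => <-; exact: Sel_median_le_E_max.
move=> v; move: fM fz convex; case: (E_max P yL yU m) => // e _.
case: ('E_P[z]) => // c _ convex; rewrite !lee_fin => /andP[cv ve].
(* The weight (e - v) / (e - c) of z needs the two means to be distinct. *)
have [ec|ce] := leP e c.
  have [|y Yy yE] := convex 0%R; first by rewrite ler01 lexx.
  exists y => //; rewrite yE -!EFinM -EFinD; congr EFin; lra.
have ec0 : (e - c != 0)%R by rewrite gt_eqF// subr_gt0.
have [|y Yy yE] := convex ((e - v) / (e - c))%R.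
  by rewrite divr_ge0/= ?subr_ge0 ?(ltW ce)// ler_pdivrMr ?subr_gt0// mul1r lerB.
by exists y => //; rewrite yE -!EFinM -EFinD; congr EFin; field.
Qed.

End upper_end.

(** * Reflection *)

Section reflection.
Context d (T : measurableType d) (R : realType) (P : probability T R).
Implicit Types (y yL yU : {RV P >-> R}) (m : R).

(** Named so that the opposite keeps its type of random variables. *)
Definition opp_rv y : {RV P >-> R} := (- y)%R.

Lemma expectation_opp y : P.-integrable setT (EFin \o y) ->
  'E_P[opp_rv y] = - 'E_P[y].
Proof. by move=> iy; rewrite unlock -integralN//; exact: integrable_add_def. Qed.

Lemma A_mid_opp yL yU m :
  A_mid P (opp_rv yU) (opp_rv yL) (- m)%R = A_mid P yL yU m.
Proof. by apply/seteqP; split=> w; rewrite /A_mid/= !lerN2 andbC. Qed.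

Lemma p_minus_opp yL m : p_minus P (opp_rv yL) (- m)%R = p_plus P yL m.
Proof.
by congr (fine (P _)); apply/seteqP; split=> w; rewrite /A_minus/A_plus/= ltrN2.
Qed.

Lemma p_plus_opp yU m : p_plus P (opp_rv yU) (- m)%R = p_minus P yU m.
Proof.
by congr (fine (P _)); apply/seteqP; split=> w; rewrite /A_minus/A_plus/= ltrN2.
Qed.

Lemma Sel_opp yL yU y : Sel P (random_interval P yL yU) y ->
  Sel P (random_interval P (opp_rv yU) (opp_rv yL)) (opp_rv y).
Proof.
apply: filterS => w; rewrite /random_interval/= !in_itv/= !lerN2.
by rewrite andbC.
Qed.

Lemma median_set_opp y m : median_set P y m -> median_set P (opp_rv y) (- m)%R.
Proof.
move=> [le ge]; split.
  by rewrite (_ : [set w | _] = [set w | (m <= y w)%R])//;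
    apply/seteqP; split=> w /=; rewrite lerN2.
by rewrite (_ : [set w | _] = [set w | (y w <= m)%R])//;
  apply/seteqP; split=> w /=; rewrite lerN2.
Qed.

Lemma Sel_median_opp yL yU y m : Sel_median P (random_interval P yL yU) m y ->
  Sel_median P (random_interval P (opp_rv yU) (opp_rv yL)) (- m)%R (opp_rv y).
Proof. by move=> [Yy my]; split; [exact: Sel_opp|exact: median_set_opp]. Qed.

Lemma opp_rvK y : opp_rv (opp_rv y) = y.
Proof. by apply/mfuneqP => w /=; rewrite opprK. Qed.

(** Reflection exchanges the gap above [m] with the gap below it. *)
Lemma E_max_opp yL yU m : P.-integrable setT (EFin \o yL) ->
  E_max P (opp_rv yU) (opp_rv yL) (- m)%R = - E_min P yL yU m.
Proof.
move=> iL; rewrite /E_max /E_min expectation_opp// oppeD; last first.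
  by rewrite fin_num_adde_defr// unlock integrable_fin_num.
rewrite /quantile_cost /p_mid A_mid_opp.
rewrite (_ : upper_gap P (opp_rv yL) (- m)%R = lower_gap P yL m); last first.
  by apply/funext => w; rewrite /upper_gap /lower_gap/= opprK addrC.
by rewrite (_ : alpha_minus P (opp_rv yL) (- m)%R = alpha_plus P yL m)//
  /alpha_minus p_minus_opp.
Qed.

End reflection.

Theorem proposition2p7 (d : measure_display) (T : measurableType d)
    (R : realType) (P : probability T R)
    (Pcomplete : measure_is_complete P) (Pnonatomic : nonatomic P)
    (yL yU : {RV P >-> R})
    (yLU : P [set w | (yL w <= yU w)%R] = 1)
    (yint : 'E_P[fun w => `|yL w|%R] + 'E_P[fun w => `|yU w|%R] < +oo)
    (m : R)
    (feas_minus : (p_minus P yU m <= 2^-1)%R)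
    (feas_plus : (p_plus P yL m <= 2^-1)%R) :
  let Y := random_interval P yL yU in
  [/\ E_min P yL yU m \is a fin_num /\ E_max P yL yU m \is a fin_num,
      [set 'E_P[y] | y in Sel_median P Y m]
        = `[E_min P yL yU m, E_max P yL yU m]%classic,
      exists2 y : {RV P >-> R}, Sel_median P Y m y & 'E_P[y] = E_max P yL yU m,
      exists2 y : {RV P >-> R}, Sel_median P Y m y & 'E_P[y] = E_min P yL yU m
    & forall v : R, E_min P yL yU m <= v%:E <= E_max P yL yU m ->
        exists2 y : {RV P >-> R}, Sel_median P Y m y & 'E_P[y] = v%:E].
Proof.
move=> Y.
have LU : {ae P, forall w, (yL w <= yU w)%R}.
  have mS : measurable [set w | (yL w <= yU w)%R].
    have := measurable_fun_ler (f := yL) (g := yU) (D := setT).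
    by move=> /(_ _ _ measurableT [set true] I); rewrite setTI; apply.
  exists (~` [set w | (yL w <= yU w)%R]); split=> //; first exact: measurableC.
  by rewrite probability_setC// yLU subee.
have absE (y : {RV P >-> R}) : 'E_P[fun w => `|y w|%R] < +oo ->
    P.-integrable setT (EFin \o y).
  rewrite unlock => yoo; apply/integrableP; split; first exact/measurable_EFinP.
  exact: yoo.
have abs0 (y : {RV P >-> R}) : 0 <= 'E_P[fun w => `|y w|%R].
  exact: expectation_ge0.
have iL : P.-integrable setT (EFin \o yL).
  by apply: absE; apply: le_lt_trans yint; rewrite leeDl.
have iU : P.-integrable setT (EFin \o yU).
  by apply: absE; apply: le_lt_trans yint; rewrite leeDr.
(* m clamped to [yL, yU], the common end of the two segments of selections *)
have [z zE] : exists z : {RV P >-> R},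
    (z : T -> R) = (fun w => Num.max (yL w) (Num.min m (yU w))).
  by apply: random_variable_of; apply: measurable_maxr => //; exact: measurable_minr.
have Yz : Sel P Y z.
  apply: filterS LU => w Lw; rewrite /Y /random_interval/= in_itv/= zE.
  by rewrite le_max lexx/= ge_max Lw ge_min lexx orbT.
have zM w : A_mid P yL yU m w -> z w = m.
  by move=> /andP[Lm mU]; rewrite zE (min_l mU) (max_r Lm).
have [fmax zmax upper] := upper_half LU iL iU feas_minus feas_plus Pnonatomic Yz zM.
have iz := Sel_integrable iL iU Yz.
have LU' : {ae P, forall w, (opp_rv yU w <= opp_rv yL w)%R}.
  by apply: filterS LU => w; rewrite /= lerN2.
have iNL : P.-integrable setT (EFin \o opp_rv yL) by have := integrableN iL.
have iNU : P.-integrable setT (EFin \o opp_rv yU) by have := integrableN iU.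
have feas_minus' : (p_minus P (opp_rv yL) (- m)%R <= 2^-1)%R by rewrite p_minus_opp.
have feas_plus' : (p_plus P (opp_rv yU) (- m)%R <= 2^-1)%R by rewrite p_plus_opp.
have zM' w : A_mid P (opp_rv yU) (opp_rv yL) (- m)%R w -> opp_rv z w = (- m)%R.
  by rewrite A_mid_opp => /zM zw; rewrite -zw.
have [fmin zmin lower] :=
  upper_half LU' iNU iNL feas_minus' feas_plus' Pnonatomic (Sel_opp Yz) zM'.
rewrite E_max_opp// in fmin zmin lower.
rewrite expectation_opp// in zmin lower.
rewrite fin_numN in fmin.
rewrite leeN2 in zmin.
have reach v : E_min P yL yU m <= v%:E <= E_max P yL yU m ->
    exists2 y : {RV P >-> R}, Sel_median P Y m y & 'E_P[y] = v%:E.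
  move=> /andP[minv vmax]; have [zv|vz] := leP 'E_P[z] v%:E.
    by apply: upper; rewrite zv.
  have [|y Yy yE] := lower (- v)%R; first by rewrite EFinN !leeN2 minv ltW.
  exists (opp_rv y); last first.
    rewrite expectation_opp ?yE ?EFinN ?oppeK//.
    by case: Yy => Yy _; exact: (Sel_integrable iNU iNL Yy).
  by have := Sel_median_opp Yy; rewrite !opp_rvK opprK.
have minmax := le_trans zmin zmax.
split=> //.
- apply/seteqP; split=> [_ [y Yy <-]|e].
    rewrite /= in_itv/=; apply/andP; split.
      have iy : P.-integrable setT (EFin \o y).
        by case: Yy => Yy _; exact: (Sel_integrable iL iU Yy).
      rewrite -leeN2 -(E_max_opp yU m iL) -(expectation_opp iy).
      by apply: Sel_median_le_E_max => //; exact: Sel_median_opp.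
    exact: Sel_median_le_E_max.
  rewrite /= in_itv/=; case: e => [r /reach[y Yy yE]|/andP[_]|/andP[+ _]].
  - by exists y.
  - by rewrite leye_eq => /eqP eoo; move: fmax; rewrite eoo.
  - by rewrite leeNy_eq => /eqP eoo; move: fmin; rewrite eoo.
- have := reach (fine (E_max P yL yU m)); rewrite fineK//; apply.
  by rewrite minmax lexx.
- have := reach (fine (E_min P yL yU m)); rewrite fineK//; apply.
  by rewrite minmax lexx.
Qed.
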